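(* Let $T$ be a tree, let $\mu$ be a positive function on $T$, and let $\varphi$ be a self-map of $T$ such that $C_\varphi$ is bounded on $L_\mu^\infty$. If $\varphi$ is surjective and $\frac{\mu(v)}{\mu(\varphi(v))} = 1$ for all $v \in T$, then $C_\varphi$ is an isometry on $L_\mu^\infty$.
   Context: A tree $T$ is a locally finite, connected, simply-connected graph, identified as a set with its set of vertices; it is assumed to have no terminal vertices (a vertex is terminal if it has a unique neighbor), hence to be infinite, and it is rooted at a vertex $o$. A function on $T$ is a complex-valued function on the set of vertices. For a positive function $\mu: T \to (0,\infty)$ (the weight), $L_\mu^\infty$ is the Banach space of all functions $f$ on $T$ with $\|f\|_\mu = \sup_{v \in T} \mu(v)|f(v)| < \infty$. For an arbitrary self-map $\varphi$ of (the vertex set of) $T$, the composition operator is $C_\varphi f = f \circ \varphi$; it is bounded on $L_\mu^\infty$ if it maps $L_\mu^\infty$ into itself as a bounded linear operator. It is an isometry on $L_\mu^\infty$ if $\|C_\varphi f\|_\mu = \|f\|_\mu$ for all $f \in L_\mu^\infty$ (surjectivity is not required). *)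

(* Defs.v *)
From Stdlib Require Export Reals List Relations FinFun.
From Coquelicot Require Export Coquelicot.
Import ListNotations.

Set Implicit Arguments.

Section Graph.

Variables (V : Type) (adj : V -> V -> Prop).

Definition locally_finite : Prop :=
  forall v, exists l : list V, forall w, adj v w -> In w l.

Definition connected : Prop := forall v w, clos_refl_trans V adj v w.

(** [walk x p]: the vertices [x :: p] are traversed along edges. *)
Fixpoint walk (x : V) (p : list V) : Prop :=
  match p with
  | [] => True
  | y :: p' => adj x y /\ walk y p'
  end.

(** A graph has no 2-cells, so the homotopy of edge paths (with fixed
    endpoints) is generated by the removal of backtrackings. *)
Inductive backtrack : list V -> list V -> Prop :=
| backtrack_intro p x y q :
    adj x y -> backtrack (p ++ x :: y :: x :: q) (p ++ x :: q).

Definition homotopic : list V -> list V -> Prop :=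
  clos_refl_sym_trans (list V) backtrack.

(** Triviality of the edge-path groups at all base points; connectedness is
    required separately. *)
Definition simply_connected : Prop :=
  forall x p, walk x p -> last p x = x -> homotopic (x :: p) [x].

Definition terminal (v : V) : Prop := exists! w, adj v w.

End Graph.

(** [tree_infinite] only rules out the one-vertex graph, whose vertex has no
    neighbor and hence is not terminal. *)
Record tree : Type := Tree {
  vertex :> Type;
  adj : vertex -> vertex -> Prop;
  root : vertex;
  adj_sym : forall v w, adj v w -> adj w v;
  adj_irrefl : forall v, ~ adj v v;
  tree_locally_finite : locally_finite adj;
  tree_connected : connected adj;
  tree_simply_connected : simply_connected adj;
  tree_no_terminal : forall v, ~ terminal adj v;
  tree_infinite : ~ FinFun.Finite vertex
}.

Section WeightedSpace.

Context {T : tree} (mu : T -> R).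

(** The supremum is taken in the extended reals, so it is [p_infty] for
    functions outside of the space. *)
Definition wnorm (f : T -> C) : Rbar :=
  Lub_Rbar (fun x : R => exists v : T, x = (mu v * Cmod (f v))%R).

Definition Linfty (f : T -> C) : Prop := Rbar_lt (wnorm f) p_infty.

Definition bounded_operator (A : (T -> C) -> (T -> C)) : Prop :=
  (forall f, Linfty f -> Linfty (A f)) /\
  (forall (a b : C) f g, Linfty f -> Linfty g -> forall v,
     A (fun w => a * f w + b * g w)%C v = (a * A f v + b * A g v)%C) /\
  (exists M : R, forall f, Linfty f ->
     Rbar_le (wnorm (A f)) (Rbar_mult (Finite M) (wnorm f))).

(** Surjectivity of [A] is not required. *)
Definition isometry (A : (T -> C) -> (T -> C)) : Prop :=
  forall f, Linfty f -> wnorm (A f) = wnorm f.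

End WeightedSpace.

Definition comp_op {T : tree} (phi : T -> T) (f : T -> C) : T -> C :=
  fun v => f (phi v).

(* Main.v *)
Require Import Defs.

(** The ratio condition says that [mu] is constant along [phi], so the weighted
    modulus of [comp_op phi f] at [v] is that of [f] at [phi v]. As [phi] is
    surjective, [f] and [comp_op phi f] have the same set of weighted moduli,
    hence the same supremum. *)

Theorem theorem5p1 (T : tree) (mu : T -> R) (hmu : forall v : T, (0 < mu v)%R)
    (phi : T -> T) (hbdd : bounded_operator mu (comp_op phi))
    (hsurj : Surjective phi)
    (hratio : forall v : T, (mu v / mu (phi v) = 1)%R) :
  isometry mu (comp_op phi).
Proof.
  assert (hinv : forall v : T, mu v = mu (phi v)).
  { intros v. rewrite <- (Rmult_1_l (mu (phi v))), <- (hratio v).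
    field. apply Rgt_not_eq, hmu. }
  intros f _. apply Lub_Rbar_eqset. intros x. unfold comp_op. split.
  - intros [v ->]. exists (phi v). now rewrite (hinv v).
  - intros [w ->]. destruct (hsurj w) as [v <-]. exists v. now rewrite (hinv v).
Qed.
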